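(* Let $G$ be a finite abelian group and $S\subseteq G$ a symmetric subset with $0\notin S$, such that the principal character $\chi_0$ is the only real character of $G$ (for instance if $|G|$ is odd). For each $\chi\in\widehat G\smallsetminus\{\chi_0\}$ with $e_\chi\neq 0,\pm|S|$, we have $$m^{+}(e_\chi)=m^{+}(-e_\chi)=\tfrac12\{m(e_\chi)+m(-e_\chi)\}.$$ In particular, $Spec(X(G,S))$ determines $Spec(X^+(G,S))$. If, in addition, $G$ has a non-trivial character $\chi$ such that $-e_\chi$ is not an eigenvalue of $X(G,S)$, then $X(G,S)$ and $X^+(G,S)$ are non-isospectral.
   Context: For a finite abelian group $G$ (written additively) and a symmetric subset $S$ ($-S=S$) with $0\notin S$: $X(G,S)$ is the graph with vertex set $G$ in which $v,w$ are adjacent iff $w-v\in S$; $X^+(G,S)$ is the graph with vertex set $G$ in which $v,w$ are adjacent iff $v+w\in S$ (loops allowed, at $x$ with $x+x\in S$). Eigenvalues are those of the adjacency matrix (a loop gives a diagonal entry $1$); $Spec$ is the multiset of eigenvalues with multiplicity; two graphs are isospectral if they have the same $Spec$. $m(\lambda)$ (resp. $m^+(\lambda)$) is the multiplicity of $\lambda$ as an eigenvalue of $X(G,S)$ (resp. $X^+(G,S)$), being $0$ if $\lambda$ is not an eigenvalue. $\widehat G$ is the set of group homomorphisms $\chi:G\to\mathbb{S}^1\subset\mathbb{C}^*$; $\chi_0$ is the constant character $1$; $\chi$ is real if $\chi=\chi^{-1}$, i.e. all its values are real; $e_\chi=\sum_{s\in S}\chi(s)\in\mathbb{R}$. ''$Spec(X(G,S))$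 determines $Spec(X^+(G,S))$'' means that, among pairs $(G,S)$ satisfying the hypotheses, the multiset $Spec(X^+(G,S))$ depends only on the multiset $Spec(X(G,S))$. *)

(* Defs.v *)
From HB Require Import structures.
From mathcomp Require Import all_boot all_order all_algebra.
From mathcomp Require Import finmap multiset.

Set Implicit Arguments.
Unset Strict Implicit.
Unset Printing Implicit Defensive.

Import Order.TTheory GRing.Theory Num.Theory.
Local Open Scope ring_scope.
Local Open Scope mset_scope.

(* The role of the complex numbers is played by an arbitrary                  *)
(* C : numClosedFieldType; this covers R[i] for any real closed field R,      *)
(* hence the usual complex numbers, as well as algC.                          *)

(* A graph on a finite vertex set is given by its adjacency relation; a loop  *)
(* at x is e x x.                                                             *)

Definition adjacency_mx (C : numClosedFieldType) (T : finType) (e : rel T) :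
  'M[C]_#|T| :=
  \matrix_(i, j) (e (enum_val i) (enum_val j))%:R.

(* The characteristic polynomial is monic, so its roots, listed with          *)
(* multiplicity, are those of the factorisation below.                        *)
Definition Spec (C : numClosedFieldType) (T : finType) (e : rel T) : {mset C} :=
  seq_mset (sval (closed_field_poly_normal (char_poly (adjacency_mx C e)))).

Definition eigenvalue_of (C : numClosedFieldType) (T : finType) (e : rel T)
    (a : C) : bool :=
  eigenvalue (adjacency_mx C e) a.

Definition multiplicity (C : numClosedFieldType) (T : finType) (e : rel T)
    (a : C) : nat :=
  Spec C e a.

Definition isospectral (C : numClosedFieldType) (T1 T2 : finType)
    (e1 : rel T1) (e2 : rel T2) : Prop :=
  Spec C e1 = Spec C e2.

Definition symmetric_set (G : finZmodType) (S : {set G}) : Prop :=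
  [set - s | s in S] = S.

Definition cayley_graph (G : finZmodType) (S : {set G}) : rel G :=
  [rel v w | w - v \in S].

Definition cayley_sum_graph (G : finZmodType) (S : {set G}) : rel G :=
  [rel v w | v + w \in S].

Definition is_character (C : numClosedFieldType) (G : finZmodType)
    (chi : {ffun G -> C}) : Prop :=
  (forall x, `|chi x| = 1) /\ (forall x y, chi (x + y) = chi x * chi y).

Definition principal_character (C : numClosedFieldType) (G : finZmodType) :
  {ffun G -> C} := [ffun => 1].

Definition inverse_character (C : numClosedFieldType) (G : finZmodType)
    (chi : {ffun G -> C}) : {ffun G -> C} :=
  [ffun x => (chi x)^-1].

Definition real_character (C : numClosedFieldType) (G : finZmodType)
    (chi : {ffun G -> C}) : Prop :=
  chi = inverse_character chi.

Definition only_principal_real (C : numClosedFieldType) (G : finZmodType) :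
    Prop :=
  forall chi : {ffun G -> C}, is_character chi -> real_character chi ->
    chi = principal_character C G.

Definition character_sum (C : numClosedFieldType) (G : finZmodType)
    (S : {set G}) (chi : {ffun G -> C}) : C :=
  \sum_(s in S) chi s.

(* Main.v *)
Require Import Defs.
From HB Require Import structures.
From mathcomp Require Import all_boot all_order all_algebra.
From mathcomp Require Import finmap multiset.

Set Implicit Arguments.
Unset Strict Implicit.
Unset Printing Implicit Defensive.

Import Order.TTheory GRing.Theory Num.Theory.
Local Open Scope ring_scope.

(** Write d for the cardinal of S, A for the adjacency matrix of the Cayley
graph, B for that of the Cayley sum graph. The characters diagonalise A, and
B exchanges the lines of chi and of its inverse up to the factor e_chi; so,
when no chi other than the principal one is real, the spectrum of B consists
of d and of a pair {e_chi, - e_chi} for each pair {chi, chi^-1}. The proof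
below obtains this count without decomposing the space of functions on G into
characters: multisets of numbers in characteristic zero are determined by
their power sums ([perm_eq_power_sums]), and the power sums of a spectrum are
traces of powers of the adjacency matrix, that is, numbers of closed walks
([sum_eigenvalues_walks]).

Walks in the sum graph are walks in the Cayley graph up to inversion: since
v + u is in S iff - u is adjacent to v in the Cayley graph, a sum-graph walk of
length k from v to w is a Cayley walk from v to w or to - w according to the
parity of k ([walks_cayley_sum]). Hence closed walks of even length are
equinumerous. For odd k one counts the Cayley walks from v to - v, which by
translation are the walks from 0 to - 2v; if x |-> 2x is a bijection of G, then
- 2v runs over G and the total is d^k, the number of all walks of length k
from 0. So the k-th power sum of the spectrum of B is that of A for k even and
d^k for k odd. These numbers are those of the multiset identity
   2 Spec(B) + {- d} = Spec(A) + (- Spec(A)) + {d},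
which is [multiplicity_cayley_sum]; away from d and - d it is the announced
formula. They also show that Spec(A) and d determine Spec(B), and d is read
off Spec(A), because the number of closed walks of length 0 is the order of G
and that of length 2 is d times this order ([Spec_card]).

Doubling is bijective exactly when G has no real character but the principal
one: if z is not a double, a maximal subgroup among those that contain all
doubles and avoid z has index two, and the sign character that it defines
takes the value - 1 at z ([real_character_nondouble]).

Finally, chi - chi^-1 is an eigenvector of B for - e_chi, nonzero when chi is
not real ([character_sum_opp_eigenvalue]); if - e_chi is not an eigenvalue of
A, the two spectra differ. *)

(** * Power sums determine a multiset *)

Lemma sum_horner (R : numDomainType) (s : seq R) (p : {poly R}) :
  \sum_(x <- s) p.[x] = \sum_(i < size p) p`_i * \sum_(x <- s) x ^+ i.
Proof.
under eq_bigr do rewrite horner_coef.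
by rewrite exchange_big; apply: eq_bigr => i _; rewrite mulr_sumr.
Qed.

(** Equal power sums give equal sums of every polynomial over s and t. The
polynomial vanishing at all entries of s and t except y then compares the two
multiplicities of y, which are equal in characteristic zero. *)
Lemma perm_eq_power_sums (R : numDomainType) (s t : seq R) :
  (forall k, \sum_(x <- s) x ^+ k = \sum_(x <- t) x ^+ k) -> perm_eq s t.
Proof.
move=> eq_pow; apply/allP => y _ /=.
pose z := filter (predC1 y) (s ++ t).
pose p := \prod_(x <- z) ('X - x%:P).
have p_y : p.[y] != 0.
  by rewrite -/(root p y) root_prod_XsubC mem_filter /= eqxx.
have sum_p u : {subset u <= s ++ t} ->
    \sum_(x <- u) p.[x] = (count_mem y u)%:R * p.[y].
  move=> sub_u; rewrite (bigID (pred1 y)) /= [X in _ + X]big1_seq ?addr0.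
    rewrite (eq_bigr (fun=> p.[y])) => [|x /eqP-> //].
    by rewrite big_const_seq iter_addr_0 mulr_natl.
  move=> x /andP[x'y u_x]; apply/eqP; rewrite -/(root p x) root_prod_XsubC.
  by rewrite mem_filter /= x'y sub_u.
have: \sum_(x <- s) p.[x] = \sum_(x <- t) p.[x].
  by rewrite !sum_horner; apply: eq_bigr => i _; rewrite eq_pow.
rewrite !sum_p => [/(mulIf p_y)/eqP||]; first by rewrite eqr_nat.
  by move=> x t_x; rewrite mem_cat t_x orbT.
by move=> x s_x; rewrite mem_cat s_x.
Qed.

(** * Power sums of a spectrum as numbers of closed walks *)

Definition eigenvalues (C : numClosedFieldType) (T : finType) (e : rel T) :
    seq C :=
  sval (closed_field_poly_normal (char_poly (adjacency_mx C e))).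

Lemma char_poly_adjacency (C : numClosedFieldType) (T : finType) (e : rel T) :
  char_poly (adjacency_mx C e) = \prod_(a <- eigenvalues C e) ('X - a%:P).
Proof.
rewrite /eigenvalues; case: closed_field_poly_normal => s /= {1}->.
by rewrite (monicP (char_poly_monic _)) scale1r.
Qed.

Lemma multiplicityE (C : numClosedFieldType) (T : finType) (e : rel T) (a : C) :
  multiplicity e a = count_mem a (eigenvalues C e).
Proof. exact: mset_seqE. Qed.

Lemma eigenvalue_ofE (C : numClosedFieldType) (T : finType) (e : rel T)
    (a : C) :
  eigenvalue_of e a = (a \in eigenvalues C e).
Proof.
by rewrite /eigenvalue_of eigenvalue_root_char char_poly_adjacency
           root_prod_XsubC.
Qed.

Lemma adjacency_mx_normal (C : numClosedFieldType) (T : finType) (e : rel T) :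
  symmetric e -> adjacency_mx C e \is normalmx.
Proof.
move=> e_sym; apply: symmetric_normalmx.
  apply/is_hermitianmxP; rewrite expr0 scale1r map_mx_id //.
  by apply/matrixP=> i j; rewrite !mxE e_sym.
by apply/mxOverP=> i j; rewrite mxE realn.
Qed.

Lemma diag_mx_exp (R : comPzRingType) n (d : 'rV[R]_n) k :
  diag_mx d ^+ k = diag_mx (\row_i d 0 i ^+ k).
Proof.
elim: k => [|k IHk].
  by apply/matrixP=> i j; rewrite !mxE expr0.
rewrite exprS IHk; apply/matrixP=> i j.
by rewrite -mulmxE mul_diag_mx !mxE mulrnAr exprS.
Qed.

(** A symmetric 0-1 matrix is normal, hence by the spectral theorem similar to
a diagonal matrix, for which both sides can be read off the diagonal. *)
Lemma sum_eigenvalues_exp (C : numClosedFieldType) (T : finType) (e : rel T) k :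
  symmetric e ->
  \sum_(a <- eigenvalues C e) a ^+ k = \tr (adjacency_mx C e ^+ k).
Proof.
move=> /(adjacency_mx_normal C)/orthomx_spectralP.
have := char_poly_adjacency C e.
set A := adjacency_mx C e; set P := spectralmx A; set d := spectral_diag A.
move=> charA defA; have Pu : P \in unitmx := spectral_unit A.
have /prod_XsubC_eq/(perm_big _) -> :
    \prod_(a <- eigenvalues C e) ('X - a%:P)
    = \prod_(a <- [seq d 0 i | i : 'I_#|T|]) ('X - a%:P).
  rewrite -charA big_image /= {1}defA.
  transitivity (char_poly (diag_mx d)); last first.
    rewrite char_poly_trig ?diag_mx_is_trig //.
    by apply: eq_bigr => i _; rewrite mxE eqxx.
  rewrite /char_poly /char_poly_mx.
  set Q := map_mx polyC P; have Qu : Q \in unitmx by rewrite map_unitmx.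
  have -> : 'X%:M - map_mx polyC (invmx P *m diag_mx d *m P)
            = invmx Q *m ('X%:M - map_mx polyC (diag_mx d)) *m Q.
    rewrite mulmxBr mulmxBl mul_mx_scalar -scalemxAl mulVmx //.
    by rewrite scalemx1 !map_mxM map_invmx.
  rewrite !det_mulmx mulrAC -det_mulmx mulVmx // det1 mul1r //.
have -> : A ^+ k = invmx P *m diag_mx d ^+ k *m P.
  elim: k => [|k IHk]; first by rewrite mulmx1 mulVmx.
  by rewrite exprS IHk {1}defA [in RHS]exprS -!mulmxE !mulmxA mulmxK.
rewrite mxtrace_mulC mulmxA mulmxV // mul1mx diag_mx_exp mxtrace_diag.
by rewrite big_image /=; under [RHS]eq_bigr do rewrite mxE.
Qed.

Lemma sum_enum_val (V : nmodType) (T : finType) (F : T -> V) :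
  \sum_(i < #|T|) F (enum_val i) = \sum_x F x.
Proof. by rewrite -(big_enum_val (A := T)). Qed.

Fixpoint walks (T : finType) (e : rel T) (k : nat) (v w : T) : nat :=
  if k is k'.+1 then \sum_(u | e v u) walks e k' u w else v == w.

Lemma adjacency_mx_exp (C : numClosedFieldType) (T : finType) (e : rel T) k :
  adjacency_mx C e ^+ k
  = \matrix_(i, j) (walks e k (enum_val i) (enum_val j))%:R.
Proof.
elim: k => [|k IHk].
  by apply/matrixP=> i j; rewrite !mxE /= (inj_eq enum_val_inj).
rewrite exprS IHk; apply/matrixP=> i j; rewrite !mxE /= natr_sum.
under eq_bigr do rewrite !mxE.
rewrite (sum_enum_val (fun u => (e (enum_val i) u)%:R
                                 * (walks e k u (enum_val j))%:R)).
rewrite [RHS]big_mkcond; apply: eq_bigr => u _.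
by case: (e _ u); rewrite ?mul1r ?mul0r.
Qed.

Lemma sum_eigenvalues_walks (C : numClosedFieldType) (T : finType) (e : rel T)
    k :
  symmetric e ->
  \sum_(a <- eigenvalues C e) a ^+ k = (\sum_v walks e k v v)%:R.
Proof.
move=> /sum_eigenvalues_exp->; rewrite adjacency_mx_exp natr_sum.
rewrite -(sum_enum_val (fun v => (walks e k v v)%:R)).
by apply: eq_bigr => i _; rewrite mxE.
Qed.

Lemma sum_closed_walks0 (T : finType) (e : rel T) :
  (\sum_v walks e 0 v v = #|T|)%N.
Proof. by rewrite -sum1_card; apply: eq_bigr => v _ /=; rewrite eqxx. Qed.

(** * Walks in Cayley graphs and Cayley sum graphs *)

Section Cayley.

Variables (G : finZmodType) (S : {set G}).
Hypothesis S_sym : symmetric_set S.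

Lemma symmetric_setN x : (- x \in S) = (x \in S).
Proof.
by rewrite -{1}S_sym; apply/imsetP/idP=> [[y Sy /oppr_inj->]//|Sx]; exists x.
Qed.

Lemma cayley_graph_sym : symmetric (cayley_graph S).
Proof. by move=> v w; rewrite /cayley_graph /= -symmetric_setN opprB. Qed.

Lemma cayley_sum_graph_sym : symmetric (cayley_sum_graph S).
Proof. by move=> v w; rewrite /cayley_sum_graph /= addrC. Qed.

Lemma walks_translate k x v w :
  walks (cayley_graph S) k (v + x) (w + x) = walks (cayley_graph S) k v w.
Proof.
elim: k v => [|k IHk] v /=; first by rewrite (inj_eq (addIr x)).
rewrite (reindex_inj (addIr x)) /=; apply: eq_big => u //.
by rewrite /cayley_graph /= opprD addrACA subrr addr0.
Qed.

Lemma walks_opp k v w :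
  walks (cayley_graph S) k (- v) (- w) = walks (cayley_graph S) k v w.
Proof.
elim: k v => [|k IHk] v /=; first by rewrite (inj_eq oppr_inj).
rewrite (reindex_inj oppr_inj) /=; apply: eq_big => u //.
by rewrite /cayley_graph /= -opprD symmetric_setN.
Qed.

Lemma sum_walks k v : (\sum_w walks (cayley_graph S) k v w = #|S| ^ k)%N.
Proof.
elim: k v => [|k IHk] v /=.
  by rewrite (bigD1 v) //= eqxx big1 // => w; rewrite eq_sym => /negbTE->.
rewrite exchange_big /=; under eq_bigr do rewrite IHk.
rewrite (reindex_inj (addrI v)) /=.
under eq_bigl do rewrite /cayley_graph /= addrC addKr.
by rewrite sum_nat_const expnS.
Qed.

(** The map u |-> - u turns a sum-graph edge v, u into the Cayley edge
v, - u, and it is an automorphism of the Cayley graph because S is symmetric: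
every step of a sum-graph walk contributes one sign. *)
Lemma walks_cayley_sum k v w :
  walks (cayley_sum_graph S) k v w
  = walks (cayley_graph S) k v (if odd k then - w else w).
Proof.
elim: k v w => [|k IHk] v w //=; rewrite (reindex_inj oppr_inj) /=.
apply: eq_big => [u|u _].
  by rewrite /cayley_graph /cayley_sum_graph /= -symmetric_setN opprB.
by rewrite IHk -walks_opp opprK; case: odd; rewrite ?opprK.
Qed.

Lemma sum_closed_walks2 :
  (\sum_v walks (cayley_graph S) 2 v v = #|G| * #|S|)%N.
Proof.
rewrite -sum_nat_const; apply: eq_bigr => v _.
rewrite -[RHS]expn1 -(sum_walks 1 v) /= [RHS]exchange_big /=.
apply: eq_bigr => u vu; rewrite (bigD1 v) /=; last by rewrite cayley_graph_sym.
rewrite eqxx big1 => [|w /andP[_ /negbTE->]//].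
by rewrite (bigD1 u) //= eqxx big1 // => w; rewrite eq_sym => /negbTE->.
Qed.

Hypothesis doubling_inj : injective (fun x : G => x *+ 2).

(** In odd length, the walks from v to - v are, by translation, those from
0 to - 2v, and - 2v takes every value exactly once. *)
Lemma sum_closed_walks_cayley_sum k :
  (\sum_v walks (cayley_sum_graph S) k v v
   = if odd k then #|S| ^ k else \sum_v walks (cayley_graph S) k v v)%N.
Proof.
under eq_bigr do rewrite walks_cayley_sum.
case: ifP => // _; rewrite -(sum_walks k 0) [RHS](reindex_inj doubling_inj) /=.
rewrite [RHS](reindex_inj oppr_inj) /=; apply: eq_bigr => v _.
by rewrite -(walks_translate k v 0) add0r mulNrn mulr2n opprD addrNK.
Qed.

Lemma sum_eigenvalues_cayley_sum (C : numClosedFieldType) k :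
  \sum_(a <- eigenvalues C (cayley_sum_graph S)) a ^+ k
  = if odd k then #|S|%:R ^+ k
    else \sum_(a <- eigenvalues C (cayley_graph S)) a ^+ k.
Proof.
rewrite (sum_eigenvalues_walks _ _ cayley_sum_graph_sym).
rewrite (sum_eigenvalues_walks _ _ cayley_graph_sym).
by rewrite sum_closed_walks_cayley_sum; case: ifP => //; rewrite natrX.
Qed.

(** Both sides of the multiset identity
2 Spec(X+) + {- d} = Spec(X) + (- Spec(X)) + {d} have the same power sums: in
even degree each is twice that of Spec(X) plus d^k, and in odd degree each
is d^k. The terms d and - d account for the principal character, which has no
partner - d in Spec(X+). *)
Lemma multiplicity_cayley_sum (C : numClosedFieldType) (a : C) :
  ((multiplicity (cayley_sum_graph S) a).*2 + (a == - #|S|%:R)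
   = multiplicity (cayley_graph S) a + multiplicity (cayley_graph S) (- a)
     + (a == #|S|%:R))%N.
Proof.
rewrite !multiplicityE; set s := eigenvalues C (cayley_graph S).
set t := eigenvalues C (cayley_sum_graph S).
have /permP/(_ (pred1 a)) :
    perm_eq (- #|S|%:R :: t ++ t) (#|S|%:R :: s ++ map -%R s).
  apply: perm_eq_power_sums => k.
  rewrite !big_cons !big_cat /= big_map sum_eigenvalues_cayley_sum.
  under [X in _ = _ + (_ + X)]eq_bigr do rewrite exprNn.
  rewrite -mulr_sumr [(- _%:R) ^+ k]exprNn -signr_odd -/s; case: odd => /=.
    by rewrite expr1 !mulN1r subrr addr0 addKr.
  by rewrite expr0 !mul1r.
clearbody s t; rewrite /= !count_cat addnn count_map => eq_count_a.
rewrite addnC [a == - _]eq_sym eq_count_a addnC [a == _]eq_sym.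
congr (_ + _ + _)%N; by apply: eq_count => x /=; rewrite eqr_oppLR.
Qed.

End Cayley.

(** Closed walks of length 0 and 2 give the order of the group and its product
with the degree. *)
Lemma Spec_card (C : numClosedFieldType) (G G' : finZmodType)
    (S : {set G}) (S' : {set G'}) :
  symmetric_set S -> symmetric_set S' ->
  Spec C (cayley_graph S) = Spec C (cayley_graph S') -> #|S| = #|S'|.
Proof.
move=> symS symS' /eq_seq_msetP eqX.
have eq_pow k : \sum_(a <- eigenvalues C (cayley_graph S)) a ^+ k
                = \sum_(a <- eigenvalues C (cayley_graph S')) a ^+ k.
  exact: perm_big.
have eqG : #|G| = #|G'|.
  move: (eq_pow 0%N).
  rewrite !sum_eigenvalues_walks; try exact: cayley_graph_sym.
  by move/eqP; rewrite eqr_nat !sum_closed_walks0 => /eqP.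
move: (eq_pow 2%N); rewrite !sum_eigenvalues_walks;
  try exact: cayley_graph_sym.
move/eqP; rewrite eqr_nat !sum_closed_walks2 // eqG eqn_pmul2l => [/eqP//|].
by apply/card_gt0P; exists 0.
Qed.

Lemma Spec_cayley_sum (C : numClosedFieldType) (G G' : finZmodType)
    (S : {set G}) (S' : {set G'}) :
  injective (fun x : G => x *+ 2) -> injective (fun x : G' => x *+ 2) ->
  symmetric_set S -> symmetric_set S' ->
  Spec C (cayley_graph S) = Spec C (cayley_graph S') ->
  Spec C (cayley_sum_graph S) = Spec C (cayley_sum_graph S').
Proof.
move=> dG dG' symS symS' eqX; have eqS := Spec_card symS symS' eqX.
apply/eq_seq_msetP/perm_eq_power_sums => k.
rewrite (sum_eigenvalues_cayley_sum symS dG).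
rewrite (sum_eigenvalues_cayley_sum symS' dG').
rewrite eqS; case: odd; first by [].
by apply: perm_big; apply/eq_seq_msetP.
Qed.

(** * Characters *)

Section Characters.

Variables (C : numClosedFieldType) (G : finZmodType) (chi : {ffun G -> C}).
Hypothesis chi_char : is_character chi.

Lemma character_neq0 x : chi x != 0.
Proof. by rewrite -normr_gt0 chi_char.1 ltr01. Qed.

Lemma character0 : chi 0 = 1.
Proof.
by apply: (mulfI (character_neq0 0)); rewrite -chi_char.2 addr0 mulr1.
Qed.

Lemma characterN x : chi (- x) = (chi x)^-1.
Proof.
apply: (mulfI (character_neq0 x)).
by rewrite -chi_char.2 subrr character0 mulfV ?character_neq0.
Qed.

Lemma characterMn x n : chi (x *+ n) = chi x ^+ n.
Proof.
by elim: n => [|n IHn]; rewrite ?character0 // mulrS exprS chi_char.2 IHn.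
Qed.

Lemma real_characterP : real_character chi <-> forall x, chi (- x) = chi x.
Proof.
split=> [/ffunP r x|r]; first by rewrite characterN [RHS]r ffunE.
by apply/ffunP=> x; rewrite ffunE -characterN r.
Qed.

(** The sum graph sends chi to e_chi chi^-1, and chi^-1 to e_chi chi since
the character sums of chi and chi^-1 agree on a symmetric set. So it negates,
up to the factor e_chi, the difference chi - chi^-1. *)
Lemma character_sum_opp_eigenvalue (S : {set G}) :
  symmetric_set S -> ~ real_character chi ->
  eigenvalue_of (cayley_sum_graph S) (- character_sum S chi).
Proof.
move=> symS nonreal; apply/eigenvalueP.
have sumN : character_sum S chi = \sum_(x in S) chi (- x).
  rewrite /character_sum (reindex_inj oppr_inj).
  by apply: eq_bigl => x; rewrite symmetric_setN.
exists (\row_i (chi (enum_val i) - chi (- enum_val i))).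
  apply/rowP=> j; rewrite !mxE; under eq_bigr do rewrite !mxE.
  set y := enum_val j.
  rewrite (sum_enum_val (fun x => (chi x - chi (- x)) * (x + y \in S)%:R)).
  rewrite (reindex_inj (addIr (- y))) /= mulNr -mulrN opprB mulrBr {2}sumN.
  rewrite !mulr_suml -sumrB [RHS]big_mkcond; apply: eq_bigr => x _.
  rewrite addrNK opprB !chi_char.2 [chi y * _]mulrC.
  by case: (x \in S); rewrite ?mulr1 ?mulr0.
apply/eqP=> /rowP v0; apply/nonreal/real_characterP=> x; apply/esym/eqP.
by rewrite -subr_eq0; have := v0 (enum_rank x); rewrite !mxE enum_rankK => ->.
Qed.

End Characters.

(** * Real characters and doubling *)

(** Translating by x does not change the sum of all elements of G. *)
Lemma mulrn_card (G : finZmodType) (x : G) : x *+ #|G| = 0.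
Proof.
apply: (addIr (\sum_(y : G) y)); rewrite add0r [RHS](reindex_inj (addrI x)).
by rewrite big_split sumr_const.
Qed.

(** The values of a real character square to 1 and have odd order. *)
Lemma odd_only_principal_real (C : numClosedFieldType) (G : finZmodType) :
  odd #|G| -> only_principal_real C G.
Proof.
move=> oddG chi chi_char /(real_characterP chi_char) chi_real.
apply/ffunP=> x; rewrite ffunE.
have chi2 : chi x ^+ 2 = 1.
  by rewrite expr2 -{1}chi_real -chi_char.2 addNr character0.
have: chi x ^+ #|G| = 1 by rewrite -characterMn // mulrn_card character0.
rewrite -[#|G|]odd_double_half oddG -mul2n exprD exprM chi2 expr1n mulr1.
by rewrite expr1.
Qed.

(** Take M maximal among the additively closed sets that contain all doubles
and avoid z. Such a set is a subgroup, since - x = x + 2 (- x). For y outside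
M, the union of M and its coset of y is again closed, so maximality puts z in
that coset; hence M has index two, and the character is 1 on M and - 1 off
it. *)
Lemma real_character_nondouble (C : numClosedFieldType) (G : finZmodType)
    (z : G) :
  (forall x, z != x *+ 2) ->
  exists chi : {ffun G -> C},
    [/\ is_character chi, real_character chi & chi z = -1].
Proof.
move=> z_ndbl.
pose P (M : {set G}) := [&& [forall x, x *+ 2 \in M],
  [forall x in M, forall y in M, x + y \in M] & z \notin M].
pose D := [set x *+ 2 | x : G].
have PD : P D.
  apply/and3P; split; first by apply/forallP=> x; apply: imset_f.
    apply/forall_inP=> _ /imsetP[x _ ->]; apply/forall_inP=> _ /imsetP[y _ ->].
    by rewrite -mulrnDl; apply: imset_f.
  by apply/imsetP=> -[x _ /eqP]; rewrite (negPf (z_ndbl x)).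
have [M /maxsetP[/and3P[/forallP Mdbl /forall_inP MD Mz] maxM] _] :=
  maxset_exists PD.
have {}MD x y : x \in M -> y \in M -> x + y \in M.
  by move=> Mx; apply: (forall_inP (MD x Mx)).
have MN x : (- x \in M) = (x \in M).
  suff MN' y : y \in M -> - y \in M.
    by apply/idP/idP=> /MN' //; rewrite opprK.
  move=> My; have := MD _ _ My (Mdbl (- y)).
  by rewrite mulr2n addrA subrr add0r.
have MDl x y : x \in M -> (x + y \in M) = (y \in M).
  move=> Mx; apply/idP/idP; last exact: MD.
  by rewrite -{2}(addKr x y); apply: MD; rewrite MN.
have Mzy y : y \notin M -> z + y \in M.
  move=> My; pose N := M :|: [set x | x + y \in M].
  (* N is the union of M and y + M, written with + y because y and - y are
     congruent modulo doubles. *)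
  have M_dbly x u : (x + y) + (u + y) \in M = (x + u \in M).
    by rewrite addrACA addrC -mulr2n (MDl _ _ (Mdbl y)).
  case Nz: (z \in N); first by move: Nz; rewrite /N !inE (negPf Mz).
  have PN : P N.
    apply/and3P; split; last by rewrite Nz.
      by apply/forallP=> x; rewrite /N inE Mdbl.
    apply/forall_inP=> x Nx; apply/forall_inP=> u; move: Nx; rewrite /N !inE.
    case/orP=> Mx; case/orP=> Mu.
    - by rewrite MD.
    - by rewrite -addrA (MD x (u + y)) ?orbT.
    - by rewrite addrAC (MD (x + y)) ?orbT.
    - by rewrite -M_dbly MD.
  have: y \in N by rewrite /N !inE -mulr2n Mdbl orbT.
  by rewrite (maxM N PN (subsetUl _ _)) (negPf My).
(* Both z + x and z + y lie in M, and so does their sum 2z + (x + y). *)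
have MND x y : x \notin M -> y \notin M -> x + y \in M.
  move=> Mx My; rewrite -(MDl _ _ (Mdbl z)) mulr2n addrACA.
  by rewrite MD ?Mzy.
exists [ffun x => (-1) ^+ (x \notin M)]; split; last by rewrite ffunE Mz expr1.
  split=> [x|x y]; first by rewrite ffunE normrX normrN1 expr1n.
  rewrite !ffunE -signr_addb; congr (_ ^+ nat_of_bool _).
  case Mx: (x \in M); first by rewrite MDl.
  case My: (y \in M); first by rewrite addrC MDl ?Mx.
  by rewrite MND ?Mx ?My.
by apply/ffunP=> x; rewrite !ffunE -exprVn invrN1.
Qed.

(** On a finite set it suffices that doubling be onto. *)
Lemma only_principal_real_doubling_inj (C : numClosedFieldType)
    (G : finZmodType) :
  only_principal_real C G -> injective (fun x : G => x *+ 2).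
Proof.
move=> only1; suff dblT : [set x *+ 2 | x in [set: G]] = setT.
  move=> x y; have /imset_injP : #|[set x *+ 2 | x in [set: G]]| == #|[set: G]|.
    by rewrite dblT.
  by apply; rewrite inE.
apply/setP=> z; rewrite inE; apply/imsetP.
case: (pickP (fun x : G => z == x *+ 2)) => [x /eqP-> | ndbl].
  by exists x.
have [x|chi [chi_char /only1-> // /esym/eqP]] :=
  @real_character_nondouble C G z; first by rewrite ndbl.
by rewrite ffunE eq_sym -subr_eq0 opprK -mulr2n pnatr_eq0.
Qed.

Theorem proposition2p10 (C : numClosedFieldType) :
  (forall G : finZmodType, odd #|G| -> only_principal_real C G) /\
  (forall (G : finZmodType) (S : {set G}),
     symmetric_set S -> 0 \notin S -> only_principal_real C G ->
     (forall chi : {ffun G -> C},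
        is_character chi -> chi <> principal_character C G ->
        let e := character_sum S chi in
        e <> 0 -> e <> #|S|%:R -> e <> - #|S|%:R ->
        let m := multiplicity (C := C) (cayley_graph S) in
        let mplus := multiplicity (C := C) (cayley_sum_graph S) in
        mplus e = mplus (- e) /\
        (mplus (- e))%:R = 1 / 2%:R * ((m e)%:R + (m (- e))%:R) :> rat) /\
     (forall (G' : finZmodType) (S' : {set G'}),
        symmetric_set S' -> 0 \notin S' -> only_principal_real C G' ->
        Spec C (cayley_graph S) = Spec C (cayley_graph S') ->
        Spec C (cayley_sum_graph S) = Spec C (cayley_sum_graph S')) /\
     ((exists chi : {ffun G -> C},
         [/\ is_character chi, chi <> principal_character C G
           & ~ eigenvalue_of (cayley_graph S) (- character_sum S chi)]) ->
      ~ isospectral C (cayley_graph S) (cayley_sum_graph S))).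
Proof.
split=> [G|G S symS _ only1]; first exact: odd_only_principal_real.
have dblG := only_principal_real_doubling_inj only1.
split=> [chi _ _ e _ /eqP/negPf e_d /eqP/negPf e_Nd m mplus|].
  have := multiplicity_cayley_sum symS dblG e.
  have := multiplicity_cayley_sum symS dblG (- e).
  rewrite opprK eqr_opp eqr_oppLR e_d e_Nd !addn0 -/m -/mplus => mNe me.
  have eq_mplus : mplus e = mplus (- e).
    by apply: double_inj; rewrite me mNe addnC.
  split=> //; rewrite -eq_mplus -natrD -me -mul2n natrM mulrA mul1r.
  by rewrite mulVf ?mul1r.
split=> [G' S' symS' _ /only_principal_real_doubling_inj dblG'|].
  exact: Spec_cayley_sum.
case=> chi [chi_char chi_neq1 eX] /eq_seq_msetP eqX; apply: eX.
rewrite eigenvalue_ofE (perm_mem eqX) -eigenvalue_ofE.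
by apply: character_sum_opp_eigenvalue => // /only1; auto.
Qed.
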